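(* Let $\mathcal{G}_E$ be the graph groupoid associated to a finite directed graph $E$. Then $\mathcal{G}_E$ has polynomial growth with respect to its canonical length function $l_S$ if and only if every vertex of $E$ has at most one simple cycle (i.e. for each vertex $v$ there is at most one simple cycle with center $v$).
   Context: A directed graph $E=(E^0,E^1,s,r)$ has non-empty sets $E^0$ of vertices and $E^1$ of edges and source and range maps $s,r:E^1\to E^0$; it is finite if $E^0,E^1$ are finite. A path of length $n\ge1$ is $\alpha=\alpha_1\cdots\alpha_n$ with $\alpha_i\in E^1$, $r(\alpha_i)=s(\alpha_{i+1})$; $s(\alpha)=s(\alpha_1)$, $r(\alpha)=r(\alpha_n)$, $|\alpha|=n$. Vertices are paths of length $0$ with $r(v)=s(v)=v$. $E^*$ is the set of all finite paths, $E^\infty$ the set of infinite paths $x=(x_n)_{n\ge1}$ with $r(x_i)=s(x_{i+1})$. A sink is a vertex $v$ with $s^{-1}(v)=\emptyset$. The boundary path space is $\partial E=E^\infty\cup\{\alpha\in E^*: r(\alpha)\text{ is a sink}\}$, with topology generated by $Z(v)=\{x\in\partial E: s(x)=v\}$ and $Z(\alpha)=\{x\in\partial E: x_i=\alpha_i,\ 1\le i\le|\alpha|\}$. The graph groupoid is $\mathcal{G}_E=\{(\alpha x,|\alpha|-|\beta|,\beta x):\alpha,\beta\in E^*,\ x\in\partial E,\ r(\alpha)=r(\beta)=s(x)\}$ with product $(y,m,z)(z,n,w)=(y,m+n,w)$, inverse $(y,m,z)^{-1}=(z,-m,y)$, and topology generated by the sets $Z(\alpha,\beta)=\{(\alpha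 x,|\alpha|-|\beta|,\beta x): x\in\partial E,\ r(\alpha)=r(\beta)=s(x)\}$ for $\alpha,\beta\in E^*$ with $r(\alpha)=r(\beta)$. It is an ample étale groupoid with unit space $\mathcal{G}_E^{(0)}=\{(x,0,x)\}\cong\partial E$ and source map $(y,m,z)\mapsto z$. Put $S=\bigcup_{\alpha\in E^1}\big(Z(\alpha,r(\alpha))\cup Z(r(\alpha),\alpha)\big)$. The canonical length function is $l_S(u)=0$ for $u\in\mathcal{G}_E^{(0)}$ and $l_S(g)=\inf\{n\in\mathbb{N}: g\in\bigcup_{k=1}^nS^k\}$ for $g\notin\mathcal{G}_E^{(0)}$, where $S^k$ is the set of all $k$-fold products of composable elements of $S$. $\mathcal{G}_E$ has polynomial growth with respect to a length function $l$ if there are constants $c\ge1$, $r\ge1$ with $\sup_{u\in\mathcal{G}_E^{(0)}}|\{g\in(\mathcal{G}_E)_u: l(g)\le m\}|\le c(1+m)^r$ for each $m\ge0$, where $(\mathcal{G}_E)_u$ is the set of elements with source $u$. A cycle with center $v$ is a path $\alpha$ with $|\alpha|\ge1$ and $s(\alpha)=r(\alpha)=v$; it is simple if $r(\alpha_i)\ne v$ for every $1\le i<|\alpha|$. *)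

(* Defs.v *)
From HB Require Import structures.
From mathcomp Require Import all_boot all_order all_algebra.
From mathcomp Require Import all_classical all_reals all_analysis.

Set Implicit Arguments.
Unset Strict Implicit.
Unset Printing Implicit Defensive.

Import Order.TTheory GRing.Theory Num.Theory.

Local Open Scope classical_set_scope.
Local Open Scope ring_scope.

Record finDigraph := FinDigraph {
  vertex : finType;
  edge : finType;
  src : edge -> vertex;
  rng : edge -> vertex;
  vertex_nonempty : (0 < #|vertex|)%N;
  edge_nonempty : (0 < #|edge|)%N }.

Section GraphGroupoid.
Variable E : finDigraph.

Definition sink (v : vertex E) : Prop := forall e : edge E, src e <> v.

(* A finite path is a pair (source vertex, list of edges); the pair (v, [::])
   is the vertex v seen as a path of length 0. *)
Definition fwalk : Type := (vertex E * seq (edge E))%type.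

Definition fpaths : set fwalk := [set a |
  (if a.2 is e :: _ then src e = a.1 else True) /\
  sorted (fun e f : edge E => rng e == src f) a.2].

Definition flen (a : fwalk) : nat := size a.2.
Definition fsrc (a : fwalk) : vertex E := a.1.
Definition frng (a : fwalk) : vertex E := last a.1 [seq rng e | e <- a.2].

Definition vertex_path (v : vertex E) : fwalk := (v, [::]).
Definition edge_path (e : edge E) : fwalk := (src e, [:: e]).

(* Finite or infinite walks; x_n of the text (n >= 1) is x n.-1 here. *)
Inductive walk : Type :=
  | Fin of fwalk
  | Inf of (nat -> edge E).

HB.instance Definition _ := gen_eqMixin walk.
HB.instance Definition _ := gen_choiceMixin walk.

Definition wsrc (x : walk) : vertex E :=
  match x with Fin a => fsrc a | Inf f => src (f 0%N) end.

Definition boundary : set walk := [set x |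
  match x with
  | Fin a => fpaths a /\ sink (frng a)
  | Inf f => forall i, rng (f i) = src (f i.+1)
  end].

(* The concatenation "alpha x"; only meaningful when frng a = wsrc x.  In the
   infinite case the default value of nth supplies the tail of the sequence. *)
Definition wcat (a : fwalk) (x : walk) : walk :=
  match x with
  | Fin b => Fin (a.1, a.2 ++ b.2)
  | Inf f => Inf (fun i => nth (f (i - size a.2)%N) a.2 i)
  end.

(* G_E and its subsets are sets of triples (y, m, z) = ((y, m), z). *)
Definition triple : Type := (walk * int * walk)%type.

Definition gsource (g : triple) : walk := g.2.
Definition grange (g : triple) : walk := g.1.1.
Definition gmul (g h : triple) : triple := (g.1.1, g.1.2 + h.1.2, h.2).

Definition bisection (a b : fwalk) : set triple := [set g |
  exists x : walk, [/\ boundary x, frng a = wsrc x, frng b = wsrc x &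
    g = (wcat a x, (flen a)%:Z - (flen b)%:Z, wcat b x)]].

Definition groupoid : set triple := [set g |
  exists a b : fwalk, [/\ fpaths a, fpaths b & bisection a b g]].

Definition units : set triple := [set g |
  exists2 x : walk, boundary x & g = (x, 0, x)].

Definition fiber (u : walk) : set triple :=
  [set g | groupoid g /\ gsource g = u].

Definition mulset (A B : set triple) : set triple := [set k |
  exists g h : triple, [/\ A g, B h, gsource g = grange h & k = gmul g h]].

Fixpoint powset (A : set triple) (k : nat) : set triple :=
  match k with
  | 0 => units
  | k'.+1 => if k' is 0 then A else mulset (powset A k') A
  end.

Definition gen_set : set triple := \bigcup_(e in [set: edge E])
  (bisection (edge_path e) (vertex_path (rng e)) `|`
   bisection (vertex_path (rng e)) (edge_path e)).

(* The infimum is taken in \bar R, so that it would be +oo on an element that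
   is no product of elements of gen_set. *)
Definition canonical_length (R : realType) (g : triple) : \bar R :=
  if `[< units g >] then 0%E
  else ereal_inf [set (n%:R)%:E | n in
    [set n : nat | (\bigcup_(k in [set k : nat | (1 <= k <= n)%N])
                      powset gen_set k) g]].

(* The cardinality is counted in \bar R, infinite sets having cardinality +oo;
   the unit space is identified with the boundary path space. *)
Definition polynomial_growth (R : realType) (l : triple -> \bar R) : Prop :=
  exists c r : R, [/\ 1 <= c, 1 <= r &
    forall m : R, 0 <= m ->
      (ereal_sup [set counting [set g | fiber u g /\ (l g <= m%:E)%E]
                 | u in boundary] <= (c * (1 + m) `^ r)%:E)%E].

Definition cycle_at (v : vertex E) (a : fwalk) : Prop :=
  [/\ fpaths a, (1 <= flen a)%N, fsrc a = v & frng a = v].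

Definition simple_cycle_at (v : vertex E) (a : fwalk) : Prop :=
  cycle_at v a /\
  forall i : nat, (i.+1 < flen a)%N -> nth v [seq rng e | e <- a.2] i <> v.

End GraphGroupoid.

(* Main.v *)
(** An element of the groupoid of length at most [n] has the form
    [(alpha x, |alpha| - |beta|, beta x)] with [|alpha| + |beta| <= n]; once its
    source [beta x] is fixed, it is determined by [|beta|] and [alpha].  So the
    growth of the groupoid is, up to a linear factor, that of the number of
    paths.

    Call an edge cyclic if it lies on a cycle.  If simple cycles are unique,
    each vertex emits at most one cyclic edge, while a non-cyclic edge occurs at
    most once in a path.  Hence a path of length at most [n] is determined by
    its length, its initial vertex and the index of the first occurrence of each
    edge, which leaves polynomially many paths.

    Conversely, two distinct simple cycles [a] and [b] at [v] are not prefixes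
    of each other, so [ab] and [ba] are distinct closed walks of the same length
    [L]; their words give [2 ^ n] elements of length at most [n L] with source
    [x], for any boundary path [x] starting at [v]. *)
Require Import Defs.
From mathcomp Require Import all_boot all_order all_algebra.
From mathcomp Require Import all_classical all_reals all_analysis.
From mathcomp Require Import zify.

Import Order.TTheory GRing.Theory Num.Theory.
Local Open Scope classical_set_scope.

(** * Counting measure and growth estimates *)

Lemma counting_le_card {R : realType} {U : choiceType} {T : finType}
    (A : set U) (h : U -> T) :
  {in A &, injective h} -> (@counting U R A <= (#|T|%:R)%:E)%E.
Proof.
move=> hinj; pose f (x : U) : nat := enum_rank (h x).
have finj : {in A &, injective f}.
  by move=> x y Ax Ay /ord_inj/enum_rank_inj; exact: hinj.
have leA : (A #<= `I_#|T|)%card.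
  have /card_esym/card_eqPle[le1 _] := inj_card_eq finj.
  apply: card_le_trans le1 _; apply: subset_card_le => _ [x _ <-] /=.
  exact: ltn_ord.
rewrite /counting asboolT; last by apply/finite_set_leP; exists #|T|.
by rewrite lee_fin ler_nat; exact: geq_card_fset_set.
Qed.

Lemma card_le_counting {R : realType} {U : choiceType} {T : finType}
    (A : set U) (F : T -> U) :
  injective F -> (forall t, A (F t)) -> ((#|T|%:R)%:E <= @counting U R A)%E.
Proof.
move=> Finj AF; rewrite /counting; case: asboolP => [finA|_]; last exact: leey.
rewrite lee_fin ler_nat; apply: leq_card_fset_set => //.
case: (posnP #|T|) => [->|T0].
  by rewrite II0; exact: card_ge0.
pose t0 := enum_val (Ordinal T0).
pose f (i : nat) : U := F (nth t0 (enum T) i).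
have finj : {in `I_#|T| &, injective f}.
  move=> i j; rewrite !inE /= => iT jT /Finj/eqP.
  by rewrite nth_uniq ?enum_uniq -?cardE // => /eqP.
have /card_esym/card_eqPle[le1 _] := inj_card_eq finj.
apply: card_le_trans le1 _; apply: subset_card_le => _ [i _ <-].
exact: AF.
Qed.

(* With [n = m (k + 1)], the bound [m + 1 <= 2 ^ m] raised to the power [k + 1]
   gains one factor [m + 1] over the polynomial, which absorbs all constants. *)
Lemma poly_lt_exp2 (K L k : nat) : exists n, (K * (1 + n * L) ^ k < 2 ^ n)%N.
Proof.
pose m := (K * (1 + k.+1 * L) ^ k)%N.
exists (m * k.+1)%N; rewrite expnM.
apply: (@leq_ltn_trans (K * ((1 + k.+1 * L) * m.+1) ^ k)%N).
  have expW i j : (i <= j -> i ^ k <= j ^ k)%N.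
    by case: k {m} => // k; rewrite leq_exp2r.
  by rewrite leq_mul2l expW ?orbT //; nia.
rewrite expnMn mulnA -/m.
apply: (@leq_trans (m.+1 ^ k.+1)); last by rewrite leq_exp2r // ltn_expl.
by rewrite expnS ltn_pmul2r ?expn_gt0.
Qed.

(** * Concatenation of paths and its cancellation *)

Section Paths.
Variable E : finDigraph.
Implicit Types (v : vertex E) (e f : edge E) (s t : seq (edge E)).
Implicit Types (a b : fwalk E) (x y z : walk E).

Definition adj e f := rng e == src f.

Lemma fpaths_cons v e s :
  fpaths (v, e :: s) <-> src e = v /\ fpaths (rng e, s).
Proof.
split=> -[/= <-]; first by case: s => [//|f s] /= /andP[/eqP-> ?].
by case: s => [//|f s] [/= fe ps]; split; rewrite //= fe eqxx.
Qed.

Lemma fpaths_cat v s t :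
  fpaths (v, s ++ t) <-> fpaths (v, s) /\ fpaths (frng (v, s), t).
Proof.
elim: s v => [|e s IH] v /=; first by split=> [|[]].
rewrite !fpaths_cons IH; split=> [[-> []//]|[[-> ?] ?]//].
Qed.

Lemma frng_cat v s t : frng (v, s ++ t) = frng (frng (v, s), t).
Proof. by rewrite /frng /= map_cat last_cat. Qed.

Lemma wcat_vertex x v : v = wsrc x -> wcat (vertex_path v) x = x.
Proof.
case: x => [[w s]|f] /= vx; first by rewrite vx.
congr Inf; apply: funext => i.
by rewrite nth_nil subn0.
Qed.

Lemma wcat_cat a b x : wcat a (wcat b x) = wcat (a.1, a.2 ++ b.2) x.
Proof.
case: x => [[w s]|f] /=; first by rewrite catA.
congr Inf; apply: funext => i; rewrite nth_cat size_cat subnDA.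
(* Inside [a] the default of [nth] is irrelevant; past its end the default is the value itself. *)
by case: ltnP => ia; [exact: set_nth_default | rewrite nth_default].
Qed.

Lemma wsrc_wcat a x : fpaths a -> frng a = wsrc x -> wsrc (wcat a x) = fsrc a.
Proof.
case: a => v [|e s]; first by move=> _ h; rewrite wcat_vertex.
by case: x => [[w t]|f] //= /fpaths_cons[].
Qed.

(** Prefixes of equal length can be cut off. Only edge lists are compared, because an infinite
    concatenation forgets [a.1]. *)
Lemma wcat_inj a b x y : frng a = wsrc x -> frng b = wsrc y ->
  flen a = flen b -> wcat a x = wcat b y -> a.2 = b.2 /\ x = y.
Proof.
case: a b => [v s] [w t]; rewrite /flen /= => hx hy st.
case: x y hx hy => [[v' s']|f] [[w' t']|g] //= hx hy [].
  move=> vw /eqP; rewrite eqseq_cat // => /andP[/eqP e1 /eqP e2].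
  by split=> //; rewrite -hx -hy /fsrc /= vw e1 e2.
move=> /funeqP fg; split.
  case: s t st fg {hx hy} => [|e s] [|e' t] // st fg.
  apply: (@eq_from_nth _ e) => // i ilt.
  have := fg i; rewrite (set_nth_default e) // => ->.
  by apply: set_nth_default; rewrite -st.
congr Inf; apply: funext => i; have := fg (i + size s).
by rewrite nth_default ?leq_addl // st nth_default ?leq_addl // addnK.
Qed.

Lemma boundary_edge e x : boundary x -> rng e = wsrc x ->
  boundary (wcat (edge_path e) x).
Proof.
case: x => [[w s]|f] /=.
  move=> [ps sk] ew; rewrite /fsrc/= in ew; subst w.
  by split=> //; apply/fpaths_cons.
by move=> bf ew [|i] /=; rewrite ?subn0 // nth_nil ?nth_nil subn1 subn1 /=.
Qed.

(** * Products of generators and the length function *)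

Lemma gen_setP (g : triple E) : gen_set g <-> exists e z, [/\ boundary z,
  rng e = wsrc z & g = (wcat (edge_path e) z, 1%R, z) \/
                   g = (z, (-1)%R, wcat (edge_path e) z)].
Proof.
split.
  move=> [e _ [|]] [z [bz ez _ ->]]; exists e, z; split=> //.
    by left; rewrite wcat_vertex.
  by right; rewrite wcat_vertex.
move=> [e [z [bz ez []->]]]; exists e => //; [left|right];
  by exists z; split=> //; rewrite wcat_vertex.
Qed.

(** [powset] treats exponents 0 and 1 separately; absorbing units makes the recursion uniform in
    [k]. *)
Lemma powset_mul k (g h : triple E) : powset (@gen_set E) k g -> gen_set h ->
  gsource g = grange h -> powset (@gen_set E) k.+1 (gmul g h).
Proof.
case: k => [|k]; last by move=> gk hS gh; exists g, h.
move=> [x _ ->] hS; rewrite /gsource /gmul /= add0r => ->.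
by case: h hS => -[].
Qed.

Lemma powset_inv k (g : triple E) : powset (@gen_set E) k.+1 g ->
  exists h i, [/\ powset (@gen_set E) k h, gen_set i, gsource h = grange i &
                  g = gmul h i].
Proof.
case: k => [gS|k [h [i ?]]]; last by exists h, i.
exists (grange g, 0%R, grange g), g; split=> //; last first.
  by case: g {gS} => -[y m] z; rewrite /gmul /= add0r.
exists (grange g) => //; have /gen_setP[e [z [bz ez []->]]] := gS => //=.
exact: boundary_edge.
Qed.

(** Right multiplication by a generator either deletes the first edge of [b], extends [a] when [b]
    is empty, or prepends an edge to [b]; so [flen a + flen b] grows by at most one. *)
Lemma powset_bisection k (g : triple E) : powset (@gen_set E) k g ->
  exists a b, [/\ fpaths a, fpaths b, flen a + flen b <= k & bisection a b g].
Proof.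
elim: k g => [|k IH] g.
  move=> [x bx ->]; exists (vertex_path (wsrc x)), (vertex_path (wsrc x)).
  by split=> //; exists x; split=> //; rewrite wcat_vertex.
move=> /powset_inv[h [i [/IH{IH}[a [b [pa pb abk [x [bx ax bx' ->]]]]]]]].
move=> /gen_setP[e [z [bz ez [] ->]]].
all: rewrite /gsource /grange /gmul /= => hz ->.
  case: b pb abk bx' hz => v [|f t] pb abk bx' hz.
    rewrite wcat_vertex // in hz; rewrite hz in ax *.
    exists (a.1, a.2 ++ [:: e]), (vertex_path (rng e)); split=> //.
    - apply/fpaths_cat; split; first by case: (a) pa.
      apply/fpaths_cons; split=> //.
      by case: (a) ax => a1 a2 ->; rewrite wsrc_wcat.
    - by move: abk; rewrite /flen /= size_cat /=; lia.
    exists z; split=> //; first by rewrite frng_cat.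
    rewrite wcat_cat wcat_vertex // /flen /= size_cat /=; congr (_, _, _); lia.
  have /fpaths_cons[fv pt] := pb.
  (* Cancellation identifies the first edge of [b] with [e], which the product deletes. *)
  have : wcat (v, [:: f]) (wcat (rng f, t) x) = wcat (edge_path e) z.
    by rewrite wcat_cat.
  move=> /wcat_inj[] //; first by rewrite wsrc_wcat.
  move=> [fe] xz; subst f.
  exists a, (rng e, t); split=> //; first by move: abk; rewrite /flen /=; lia.
  exists x; split=> //; rewrite xz /flen /=; congr (_, _, _); lia.
exists a, (src e, e :: b.2); split=> //.
- apply/fpaths_cons; split=> //.
  by rewrite ez -hz wsrc_wcat //; case: (b) pb.
- by move: abk; rewrite /flen /=; lia.
have eb : rng e = b.1 by rewrite ez -hz wsrc_wcat.
exists x; split=> //.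
  by rewrite -bx'; rewrite /frng /= eb.
by rewrite -hz wcat_cat /flen /=; congr (_, _, _); lia.
Qed.

(** The path is built up from its last edge since generators multiply on the right. The lower bound
    on growth only needs this case, where the second path is a vertex. *)
Lemma path_powset a x : fpaths a -> boundary x -> frng a = wsrc x ->
  powset (@gen_set E) (flen a) (wcat a x, (flen a)%:Z%R, x).
Proof.
case: a => v s; elim/last_ind: s x => [|s e IH] x.
  by move=> _ bx vx; exists x => //; rewrite wcat_vertex.
rewrite -cats1 => /fpaths_cat[ps /fpaths_cons[es _]] bx.
rewrite frng_cat => ex.
rewrite /flen /= size_cat addn1.
have -> : (wcat (v, s ++ [:: e]) x, (size s).+1%:Z%R, x) =
    gmul (wcat (v, s) (wcat (edge_path e) x), (size s)%:Z%R, wcat (edge_path e) x)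
         (wcat (edge_path e) x, 1%R, x).
  by rewrite wcat_cat /gmul /=; congr (_, _, _); lia.
apply: powset_mul => //.
  by apply: IH => //; [exact: boundary_edge | rewrite wsrc_wcat].
by apply/gen_setP; exists e, x; split=> //; left.
Qed.

Lemma canonical_length_le_powset (R : realType) n (g : triple E) :
  powset (@gen_set E) n g -> (canonical_length R g <= (n%:R)%:E)%E.
Proof.
rewrite /canonical_length; case: n => [|n] gn.
  by rewrite asboolT.
case: asboolP => _; first by rewrite lee_fin ler0n.
apply: ereal_inf_lbound; exists n.+1 => //.
by exists n.+1 => //=; rewrite leqnn.
Qed.

Lemma canonical_length_ge_powset (R : realType) (m : R) (g : triple E) :
  (0 <= m)%R -> (canonical_length R g <= m%:E)%E ->
  exists2 k, (k <= Num.truncn m)%N & powset (@gen_set E) k g.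
Proof.
move=> m0; rewrite /canonical_length; case: asboolP => [ug _|_ lem].
  by exists 0%N.
(* A strict bound by the next integer yields a member of the set without showing that the infimum is
   attained. *)
have : (ereal_inf [set (n%:R)%:E | n in [set n : nat |
    (\bigcup_(k in [set k : nat | (1 <= k <= n)%N]) powset (@gen_set E) k) g]]
    < ((Num.truncn m).+1%:R)%:E :> \bar R)%E.
  by apply: le_lt_trans lem _; rewrite lte_fin; have /andP[] := truncn_itv m0.
move=> /ereal_inf_lt[_ [n [k /= /andP[_ kn] gk] <-]].
by rewrite lte_fin ltr_nat ltnS => nm; exists k => //; exact: leq_trans nm.
Qed.

(** * Cyclic and non-cyclic edges *)

Definition cyclic e := exists2 s, path adj e s & rng (last e s) = src e.

Lemma last_take e s k d : k <= size s -> last e (take k s) = nth d (e :: s) k.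
Proof.
move=> ks; rewrite (last_nth d) size_takel //.
by rewrite -[e :: take k s]/(take k.+1 (e :: s)) nth_take.
Qed.

(** Cut the closed walk [e :: s] at its first return to [src e]. *)
Lemma cyclic_simple_cycle e :
  cyclic e -> exists s, simple_cycle_at (src e) (src e, e :: s).
Proof.
move=> [s es lasts]; pose back f := rng f == src e.
have hasq : has back (e :: s).
  by apply/hasP; exists (last e s); [exact: mem_last | rewrite /back lasts].
pose i := find back (e :: s).
have iq : i <= size s by rewrite -ltnS; move: hasq; rewrite has_find.
exists (take i s); split.
  split=> //; first by split=> //=; apply: take_path.
  rewrite /frng /= last_map (last_take _ _ _ e) //.
  by apply/eqP; exact: (nth_find e hasq).
move=> j; rewrite /flen /= size_takel // ltnS => ji.
rewrite -[_ :: _]/(map _ (take i.+1 (e :: s))) (nth_map e).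
  by rewrite nth_take ?leqW //; apply/eqP; exact: (negbT (before_find e ji)).
by rewrite size_takel //= leqW.
Qed.

(** Had the edge occurred earlier, at [j], positions [j] to [i - 1] would form a cycle through
    it. *)
Lemma acyclic_index s i d : sorted adj s -> i < size s ->
  ~ cyclic (nth d s i) -> index (nth d s i) s = i.
Proof.
move=> srt isz; set e := nth d s i => ncyc.
have eins : e \in s by exact: mem_nth.
case: (ltngtP (index e s) i) => // [ji|ij]; last first.
  by have := before_find d ij; rewrite /= eqxx.
case: ncyc; set j := index e s in ji.
have jsz : j < size s by exact: ltn_trans isz.
have dj : drop j s = e :: drop j.+1 s by rewrite (drop_nth d) // nth_index.
exists (take (i - j.+1) (drop j.+1 s)).
  by apply: take_path; have := drop_sorted j srt; rewrite dj.
rewrite (last_take _ _ _ d) ?size_drop; last by lia.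
rewrite -dj nth_drop (_ : j + _ = i.-1); last by lia.
have iE : i.-1.+1 = i by lia.
by move/(sortedP d): srt => /(_ i.-1); rewrite iE => /(_ isz)/eqP.
Qed.

(** * Polynomial growth from unique simple cycles *)

Section UniqueSimpleCycles.
Hypothesis cycle_uniq : forall v a b,
  simple_cycle_at v a -> simple_cycle_at v b -> a = b.

(** Both edges begin simple cycles at the same vertex; these coincide, hence so do their first
    edges. *)
Lemma cyclic_src_inj e f : cyclic e -> cyclic f -> src e = src f -> e = f.
Proof.
move=> /cyclic_simple_cycle[s es] /cyclic_simple_cycle[t ft] ef.
by rewrite ef in es; have [] := cycle_uniq _ _ _ es ft.
Qed.

(* At the first position where the paths could differ, a non-cyclic edge of
   either one sits at its index, hence also in the other; and two cyclic edges
   with the same source agree. *)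
Lemma fpaths_index_inj a b : fpaths a -> fpaths b -> fsrc a = fsrc b ->
  flen a = flen b -> (forall e, index e a.2 = index e b.2) -> a = b.
Proof.
case: a b => [v s] [w t] [/= vs ss] [/= wt st].
rewrite /fsrc /flen /= => vw szst idx.
subst w; congr (_, _).
case: s t vs wt ss st szst idx => [|d s] [|d' t] //.
set p := d :: s; set q := d' :: t => vs wt sp sq szpq idx.
have agree u u' i : sorted adj u -> i < size u -> size u = size u' ->
    (forall e, index e u = index e u') -> ~ cyclic (nth d u i) ->
    nth d u i = nth d u' i.
  move=> su iu uu' iuu' /(acyclic_index _ _ _ su iu) ii.
  have ii' : index (nth d u i) u' = i by rewrite -iuu' ii.
  by rewrite -[in RHS]ii' nth_index // -index_mem ii' -uu'.
have same_src i : i < size p -> src (nth d p i) = src (nth d q i) ->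
    nth d p i = nth d q i.
  move=> ip src_eq; have iq : i < size q by rewrite -szpq.
  have [cp|ncp] := pselect (cyclic (nth d p i)); last exact: agree.
  have [cq|ncq] := pselect (cyclic (nth d q i)); first exact: cyclic_src_inj.
  by apply/esym/agree.
apply: (@eq_from_nth _ d) => // i; elim: i => [|i IH] ip; apply: same_src => //.
  by rewrite /= vs wt.
move/(sortedP d): sp => /(_ _ ip)/eqP<-.
move/(sortedP d): sq => /(_ i); rewrite -szpq => /(_ ip)/eqP<-.
by rewrite IH // ltnW.
Qed.

Lemma polynomial_growth_unique_cycles (R : realType) :
  polynomial_growth (@canonical_length E R).
Proof.
(* The exponent counts one index per edge and the two path lengths; the constant counts the initial
   vertices. *)
exists #|vertex E|%:R%R, (#|edge E| + 2)%:R%R; split.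
- by rewrite ler1n vertex_nonempty.
- by rewrite ler1n addn2.
move=> m m0; apply: ge_ereal_sup => _ [u _ <-].
pose N := Num.truncn m.
pose code := ('I_N.+1 * 'I_N.+1 * vertex E * {ffun edge E -> 'I_N.+1})%type.
pose codes (g : triple E) (c : code) := exists a b, [/\ fpaths a, fpaths b,
  flen a <= N /\ flen b <= N, bisection a b g &
  c = (inord (flen a), inord (flen b), fsrc a, [ffun e => inord (index e a.2)])].
pose A g := fiber u g /\ (canonical_length R g <= m%:E)%E.
have [h hP] : {h : triple E -> code & forall g, A g -> codes g (h g)}.
  apply: (@choice _ _ (fun g c => A g -> codes g c)) => g.
  have [gA|ngA] := pselect (A g).
    have [k kN /powset_bisection[a [b [pa pb abk gab]]]] :=
      canonical_length_ge_powset _ _ _ m0 gA.2.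
    by eexists => _; exists a, b; split; last by []; rewrite //; lia.
  have /card_gt0P[v _] := vertex_nonempty E.
  (* Outside [A] any code will do. *)
  by exists (ord0, ord0, v, [ffun => ord0]).
apply: (@le_trans _ _ (#|{: code}|%:R)%:E).
  apply: (counting_le_card _ h) => g g'; rewrite !inE => gA g'A hgg'.
  have [a [b [pa pb [aN bN] [x [bx ax bx' gE]] hg]]] := hP g gA.
  have [a' [b' [pa' pb' [a'N b'N] [x' [bx2 ax2 bx2' gE']] hg']]] := hP g' g'A.
  move: hgg'; rewrite {}hg {}hg' => -[la lb va ia].
  have inordI i j : i <= N -> j <= N -> inord i = inord j :> 'I_N.+1 -> i = j.
    by move=> iN jN /(congr1 val); rewrite /= !inordK.
  have {}la := inordI _ _ aN a'N la; have {}lb := inordI _ _ bN b'N lb.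
  have aa' : a = a'.
    apply: fpaths_index_inj => // e.
    have /ffunP/(_ e) := ia; rewrite !ffunE; apply: inordI.
      by apply: leq_trans aN; exact: index_size.
    by apply: leq_trans a'N; exact: index_size.
  (* The edges of [b] are not encoded: both concatenations equal the fixed source [u], so the length
     of [b] determines the tail [x]. *)
  have bxx : wcat b x = wcat b' x'.
    by have := gA.1.2; have := g'A.1.2; rewrite gE gE' /gsource /= => -> ->.
  have [_ xx'] := wcat_inj _ _ _ _ bx' bx2' lb bxx.
  by rewrite gE gE' bxx aa' lb xx'.
rewrite !card_prod card_ffun !card_ord lee_fin powR_mulrn; last first.
  by rewrite addr_ge0.
rewrite (_ : _ * _ = #|vertex E| * N.+1 ^ (#|edge E| + 2))%N; last first.
  by rewrite expnD -mulnn; nia.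
rewrite natrM natrX ler_wpM2l ?ler0n // lerXn2r ?nnegrE ?ler0n ?addr_ge0 //.
by rewrite -natr1 addrC lerD2l truncn_le.
Qed.

End UniqueSimpleCycles.

(** * Exponential growth from two simple cycles *)

(** If [s] is shorter, commutation makes it a proper prefix of [t], which then returns to [v] too
    early. *)
Lemma simple_cycle_not_prefix v s t :
  simple_cycle_at v (v, s) -> simple_cycle_at v (v, t) ->
  size s <= size t -> s ++ t = t ++ s -> s = t.
Proof.
move=> [[_ s0 _ sv] _] [_ tsimple]; rewrite leq_eqVlt.
move=> /predU1P[szst|szst] /eqP.
  by rewrite eqseq_cat // => /andP[/eqP].
move=> /eqP/(congr1 (take (size s))); rewrite take_size_cat //.
rewrite takel_cat 1?ltnW //.
move=> st; case: (tsimple (size s).-1); rewrite /flen /= in s0 *.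
  by rewrite prednK.
rewrite -(@nth_take (size s)) ?prednK // -map_take -st -[RHS]sv /frng /=.
by rewrite (last_nth v) size_map -[in RHS](prednK s0).
Qed.

(** Unlike in [cycle_at], the empty walk is allowed, so that the empty word is covered. *)
Definition closed_walk v s := fpaths (v, s) /\ frng (v, s) = v.

Lemma closed_walk_cat v s t :
  closed_walk v s -> closed_walk v t -> closed_walk v (s ++ t).
Proof.
by move=> [ps sv] [pt tv]; split; rewrite ?fpaths_cat ?frng_cat sv.
Qed.

(** Going round the walk forever, with indices modulo its length, gives an infinite path. *)
Lemma closed_walk_boundary v s : closed_walk v s -> 0 < size s ->
  exists2 x, boundary x & wsrc x = v.
Proof.
case: s => [//|d s] [[/= dv ps] sv] _; set p := d :: s.
exists (Inf (fun i => nth d p (i %% size p))) => [i|].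
  2: by rewrite /wsrc mod0n.
have := ltn_pmod i (ltn0Sn (size s)); rewrite -[(size s).+1]/(size p).
rewrite -[i.+1]addn1 -(modnDml i 1) addn1; set k := i %% _.
rewrite leq_eqVlt => /predU1P[kp|kp].
  rewrite kp modnn /= dv -[RHS]sv /frng /= last_map (last_nth d).
  by move: kp => [->].
rewrite modn_small //; apply/eqP.
by have /(sortedP d)/(_ _ kp) : sorted adj p := ps.
Qed.

Lemma two_closed_walks_not_polynomial (R : realType) v s t :
  closed_walk v s -> closed_walk v t -> size s = size t -> s <> t ->
  ~ polynomial_growth (@canonical_length E R).
Proof.
move=> cs ct szst st [c [r [c1 r1 growth]]].
have s0 : 0 < size s.
  by move: szst st; case: (s) (t) => [|? ?] [|? ?].
have [x bx xv] := closed_walk_boundary v s cs s0.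
pose word (w : seq bool) := flatten [seq if i then s else t | i <- w].
have sz_word w : size (word w) = (size w * size s)%N.
  by elim: w => //= i w IH; rewrite size_cat IH mulSn; case: i; rewrite -?szst.
have closed_word w : closed_walk v (word w).
  by elim: w => //= i w IH; apply: closed_walk_cat => //; case: i.
(* Blocks of equal length are decoded one at a time, using [s <> t]. *)
have word_inj w w' : size w = size w' -> word w = word w' -> w = w'.
  elim: w w' => [|i w IH] [|i' w'] //= [ww'] /eqP.
  rewrite eqseq_cat; last by case: (i) (i') => -[].
  by case: i i' => -[] /andP[/eqP ? /eqP/IH-> //]; case: st.
(* Integers above [r] and [c] replace the real constants, so that [poly_lt_exp2] applies. *)
pose L := size s; pose k := (Num.truncn r).+1; pose K := (Num.truncn c).+1.
have [n] := poly_lt_exp2 K L k.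
have := growth (n * L)%:R%R (ler0n _ _); set B := (X in (_ <= X)%E).
pose F (w : n.-tuple bool) : triple E :=
  (wcat (v, word w) x, (flen (v, word w))%:Z%R, x).
have Finj : injective F.
  move=> w w' [] /wcat_inj[]; rewrite ?xv; try exact: (closed_word _).2.
    by rewrite /flen /= !sz_word !size_tuple.
  by move=> /word_inj ww' _ _; apply/val_inj/ww'; rewrite !size_tuple.
have FA w : fiber x (F w) /\ (canonical_length R (F w) <= ((n * L)%:R)%:E)%E.
  have [pw wv] := closed_word w; split.
    split=> //; exists (v, word w), (vertex_path v); split=> //.
    exists x; split; rewrite ?xv // wcat_vertex // subr0 //.
  have <- : flen (v, word w) = (n * L)%N by rewrite /flen /= sz_word size_tuple.
  by apply: canonical_length_le_powset; apply: path_powset; rewrite ?xv.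
move=> supB.
have : ((#|{: n.-tuple bool}|%:R)%:E <= B)%E.
  apply: le_trans supB; apply: le_trans (card_le_counting _ F Finj FA) _.
  by apply: ereal_sup_ubound; exists x.
rewrite card_tuple card_bool lee_fin => le2n; apply/negP; rewrite -leqNgt.
rewrite -(ler_nat R); apply: le_trans le2n _.
rewrite [leRHS]natrM natrX natrD; apply: ler_pM.
- exact: le_trans c1.
- exact: powR_ge0.
- by have /andP[_ /ltW] := truncn_itv (le_trans ler01 c1).
rewrite -powR_mulrn ?addr_ge0 //; apply: ler_powR.
  by rewrite lerDl.
by have /andP[_ /ltW] := truncn_itv (le_trans ler01 r1).
Qed.

End Paths.

Theorem proposition5p12 (R : realType) (E : finDigraph) :
  polynomial_growth (@canonical_length E R) <->
  (forall (v : vertex E) (a b : fwalk E),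
     simple_cycle_at v a -> simple_cycle_at v b -> a = b).
Proof.
split=> [growth v a b|uniq]; last exact: polynomial_growth_unique_cycles.
case: a b => [v1 s] [v2 t] sa ta.
have [[ps _ /= v1v sv] _] := sa; have [[pt _ /= v2v tv] _] := ta.
rewrite /fsrc /= in v1v v2v; subst v1 v2; congr (_, _).
(* Commuting simple cycles coincide; otherwise [s ++ t] and [t ++ s] are the two closed walks of
   equal length. *)
have [st|st] := pselect (s ++ t = t ++ s).
  case: (leqP (size s) (size t)) => szst.
    exact: (simple_cycle_not_prefix E v s t sa ta szst st).
  exact: (esym (simple_cycle_not_prefix E v t s ta sa (ltnW szst) (esym st))).
exfalso; apply: (two_closed_walks_not_polynomial E R v _ _ _ _ _ st growth).
- exact: closed_walk_cat.
- exact: closed_walk_cat.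
- by rewrite !size_cat addnC.
Qed.
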